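(* Let $(G,\tau)$ be a non-discrete central topological group. Then $G$ admits a transversal group topology if and only if $G$ satisfies one of the following conditions: (1) $G$ contains a central subgroup (i.e. a subgroup contained in the center $Z(G)$) which, with the subspace topology, is topologically isomorphic to $\mathbb{Z}$ endowed with the discrete topology; (2) there exists an open compact subgroup $F$ of $(G,\tau)$ such that $F$ is not open in $(G,\mathcal{M}_G)$.
   Context: All topological groups are Hausdorff. Two non-discrete Hausdorff group topologies $\tau,\delta$ on a group $G$ are called transversal if their least upper bound $\tau\vee\delta$ is the discrete topology. A topological group $(G,\tau)$ admits a transversal group topology if there is a group topology $\delta$ on $G$ such that $\tau$ and $\delta$ are transversal. A locally compact topological group $G$ is a central topological group if $G/Z(G)$ is compact, where $Z(G)$ is the center of $G$. For a group $G$, the submaximal group topology $\mathcal{M}_G$ is the infimum (in the lattice of all group topologies on $G$) of all maximal non-discrete group topologies on $G$, i.e. of all maximal elements of the set of non-discrete Hausdorff group topologies on $G$ ordered by inclusion; $\mathcal{M}_G$ itself is not required to be Hausdorff. *)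

(* Defs.v *)
From HB Require Import structures.
From mathcomp Require Import all_boot all_algebra.
From mathcomp Require Import all_classical.
From mathcomp Require Import topology.

Set Implicit Arguments.
Unset Strict Implicit.
Unset Printing Implicit Defensive.

Local Open Scope classical_set_scope.
Local Open Scope quotient_scope.
Local Open Scope group_scope.

(* A topology on [G] is an element [t] of the library's [Topological G]; the
   corresponding space is [topspace t]. Such a [t] also carries a choice
   structure, so topologies are compared through their open sets, never with [=]. *)

Section Topologies.
Context {G : choiceType}.
Implicit Types (s t : Topological G) (P : set (Topological G)).

Definition topspace t : topologicalType := Topological.Pack t.

Definition opens t : set (set G) := @open (topspace t).

Definition coarser s t : Prop := opens s `<=` opens t.

Definition discrete t : Prop := forall U : set G, opens t U.

Definition sup_topologies P : Topological G :=
  Topological.class (sup_topology (fun t : set_type P => set_val t)).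

(* By [group_topology_sup] below, this is also the least upper bound in the
   lattice of group topologies when [s] and [t] are group topologies. *)
Definition join_topology s t : Topological G := sup_topologies [set s; t].

Lemma coarserP s t : coarser s t <-> continuous (id : topspace t -> topspace s).
Proof. by split=> [st|/continuousP//]; apply/continuousP. Qed.

Lemma sup_topologies_ub P t : P t -> coarser t (sup_topologies P).
Proof.
move=> Pt; apply/coarserP => x.
pose i : set_type P := exist _ t (mem_set Pt).
have [+ _] := @cvg_sup G (set_type P) set_val
  (nbhs (x : topspace (sup_topologies P))) x _.
by move=> /(_ (@cvg_id _ _) i).
Qed.

Lemma sup_topologies_least P s :
  (forall t, P t -> coarser t s) -> coarser (sup_topologies P) s.
Proof.
move=> Ps; apply/coarserP => x.
apply: (@cvg_sup G (set_type P) set_val _ _ _).2 => -[t tP].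
have Pt := set_mem tP.
exact: (coarserP t s).1 (Ps t Pt) x.
Qed.

End Topologies.

Section GroupTopologies.
Context {G : groupType}.
Implicit Types (s t : Topological G) (P : set (Topological G)).

Definition group_topology t : Prop :=
  continuous (fun p : topspace t * topspace t => (p.1 * p.2 : G) : topspace t) /\
  continuous (fun x : topspace t => (x^-1 : G) : topspace t).

(* Infimum in the lattice of all, not necessarily Hausdorff, group topologies;
   it is in general strictly coarser than the infimum in the lattice of all
   topologies. *)
Definition inf_group_topology P : Topological G :=
  sup_topologies [set s | group_topology s /\ forall t, P t -> coarser s t].

Definition hausdorff_group_topology t : Prop :=
  group_topology t /\ hausdorff_space (topspace t).

Definition nondiscrete_group_topology t : Prop :=
  hausdorff_group_topology t /\ ~ discrete t.

Definition maximal_group_topology t : Prop :=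
  nondiscrete_group_topology t /\
  forall s, nondiscrete_group_topology s -> coarser t s -> coarser s t.

Definition transversal s t : Prop :=
  [/\ nondiscrete_group_topology s, nondiscrete_group_topology t
    & discrete (join_topology s t)].

Definition admits_transversal t : Prop := exists s, transversal t s.

Lemma group_topology_sup P :
  P `<=` group_topology -> group_topology (sup_topologies P).
Proof.
move=> Pg; split=> [[x y]|x].
  apply: (@cvg_sup G (set_type P) set_val _ _ _).2 => -[t tP].
  have Pt := set_mem tP.
  have idc := (coarserP t (sup_topologies P)).1 (sup_topologies_ub Pt).
  apply: (@cvg_comp _ _ _ (fun p => (p : topspace t * topspace t)) _ _
    (nbhs ((x, y) : topspace t * topspace t)) _ _ ((Pg _ Pt).1 (x, y))).
  by move=> A [[B C] [nB nC] BCA]; exists (B, C) => //; split; exact: idc.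
have nx := nbhs_filter (x : topspace (sup_topologies P)).
apply: (@cvg_sup G (set_type P) set_val _ _ (fmap_filter _ nx)).2 => -[t tP].
have Pt := set_mem tP.
have idc := (coarserP t (sup_topologies P)).1 (sup_topologies_ub Pt).
exact: cvg_comp (idc x) ((Pg _ Pt).2 x).
Qed.

Lemma inf_group_topology_group P : group_topology (inf_group_topology P).
Proof. by apply: group_topology_sup => s []. Qed.

Lemma inf_group_topology_lb P t : P t -> coarser (inf_group_topology P) t.
Proof. by move=> Pt; apply: sup_topologies_least => s [_]; exact. Qed.

Lemma inf_group_topology_greatest P s : group_topology s ->
  (forall t, P t -> coarser s t) -> coarser s (inf_group_topology P).
Proof. by move=> gs sP; apply: sup_topologies_ub. Qed.

End GroupTopologies.

Definition submaximal_topology (G : groupType) : Topological G :=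
  inf_group_topology (@maximal_group_topology G).

Section Center.
Variable G : groupType.

Definition center : set G := [set z | forall x, commute z x].

Definition is_subgroup (H : set G) : Prop :=
  [/\ H 1, (forall x y, H x -> H y -> H (x * y)) & forall x, H x -> H x^-1].

Lemma center_subgroup : is_subgroup center.
Proof.
split=> [x|x y Zx Zy z|x Zx z]; first exact/commute_sym/commute1.
  exact/commute_sym/commuteM/commute_sym/Zy/commute_sym/Zx.
exact/commute_sym/commuteV/commute_sym/Zx.
Qed.

Definition center_rel (x y : G) : bool := `[< center (x^-1 * y) >].

Lemma center_rel_refl : reflexive center_rel.
Proof. by move=> x; apply/asboolP; rewrite mulVg; case: center_subgroup. Qed.

Lemma center_rel_sym : symmetric center_rel.
Proof.
have [_ _ ZV] := center_subgroup.
by move=> x y; apply/asboolP/asboolP => /ZV; rewrite invgM invgK.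
Qed.

Lemma center_rel_trans : transitive center_rel.
Proof.
have [_ ZM _] := center_subgroup.
move=> y x z /asboolP xy /asboolP yz; apply/asboolP.
by have := ZM _ _ xy yz; rewrite -mulgA mulVKg.
Qed.

Canonical center_equiv :=
  EquivRel center_rel center_rel_refl center_rel_sym center_rel_trans.

Definition center_quotient := {eq_quot center_rel}.

End Center.

Arguments center : clear implicits.

Definition central_topological_group (G : groupType) (t : Topological G) :=
  [/\ hausdorff_group_topology t,
      locally_compact [set: topspace t]
    & compact [set: @quotient_topology (topspace t) (center_quotient G)]].

Definition isomorphic_to_discrete_Z (G : groupType) (t : Topological G)
    (C : set G) : Prop :=
  exists (f : discrete_topology int -> set_type (C : set (topspace t)))
         (g : set_type (C : set (topspace t)) -> discrete_topology int),
    [/\ cancel f g, cancel g f, continuous f, continuous g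
      & forall m n : int,
          set_val (f (m + n)%R) = (set_val (f m) : G) * (set_val (f n) : G)].

(* Main.v *)
Require Import Defs.
From HB Require Import structures.
From mathcomp Require Import all_boot all_algebra finmap.
From mathcomp Require Import all_classical.
From mathcomp Require Import topology.
From mathcomp Require Import zify.

(** Two facts about a non-discrete Hausdorff group topology [t] drive the proof.

    First, a transversal topology can be enlarged to a maximal one: by Zorn's
    lemma every non-discrete Hausdorff group topology lies below a maximal one
    ([maximal_above]), and any non-discrete enlargement of a transversal
    topology is still transversal.  Conversely a maximal topology [m] that is
    not transversal to [t] must be finer than [t], because the join of [m] and
    [t] is then a non-discrete enlargement of [m].  Moreover a subgroup is open
    in the submaximal topology as soon as it is open in every maximal topology
    ([opens_submaximal]).  So a subgroup [F] that is open for [t] but not for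
    the submaximal topology fails to be open in some maximal [m], which is
    therefore transversal to [t] ([nonopen_transversal]).

    Second, compactness forbids transversality: if [F] is compact for [s] and
    open for a transversal [t], take neighbourhoods of 1 whose intersection is
    trivial; finitely many small [s]-cosets cover [F], and a small
    [t]-neighbourhood meets each of them in at most one point, so [t] has a
    finite neighbourhood of 1 and is discrete
    ([compact_transversal_not_open]).  Applied to a maximal enlargement of a
    transversal topology, this says that no compact neighbourhood of 1 can be
    open in the submaximal topology once [tau] admits a transversal topology.

    It remains to see that a central group without a central discrete copy of
    the integers has a compact open subgroup.  In such a group every central
    [z] is recurrent: its positive powers come back to each neighbourhood of 1
    ([not_recurrent_discrete_Z]).  In a locally compact group the powers of a
    recurrent element stay in a compact set ([recurrent_powers_compact]).  As
    [G / Z(G)] is compact there is a symmetric compact neighbourhood [K] of 1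
    whose interior meets every coset of the center, so [K * K] is covered by
    finitely many translates of [K] by central elements; if [A] is the subgroup
    that these generate then [K * A] is a subgroup, and it is compact because
    [A] lies in a compact set ([compact_open_subgroup]).

    Finally, on a central discrete copy of the integers the subgroups of
    positive index form a neighbourhood base of a Hausdorff group topology
    that is transversal to [tau] ([central_discrete_Z_transversal]). *)

Set Implicit Arguments.
Unset Strict Implicit.

Local Open Scope classical_set_scope.
Local Open Scope group_scope.

(** * Topologies given by filters, joins and chains *)

(** A carrier for the topology whose open sets are those that belong to the
    filter attached to each of their points.  Starting from arbitrary filters
    avoids deciding beforehand which of their members are open. *)
Definition filter_space (T : choiceType) (N : T -> set_system T)
  (NF : forall x, Filter (N x)) : Type := T.

Section FilterSpace.
Context (T : choiceType) (N : T -> set_system T) (NF : forall x, Filter (N x)).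
Local Notation X := (filter_space NF).

Definition filter_open (W : set T) : Prop := forall x, W x -> N x W.

Fact filter_openT : filter_open setT.
Proof. by move=> x _; exact: filterT. Qed.

Fact filter_openI : setI_closed filter_open.
Proof. by move=> U V oU oV x [/oU NU /oV NV]; exact: filterI. Qed.

Fact filter_open_bigU (I : Type) (f : I -> set T) :
  (forall i, filter_open (f i)) -> filter_open (\bigcup_i f i).
Proof.
move=> of_ x [i _ fix_]; apply: filterS (of_ i x fix_).
by move=> y fiy; exists i.
Qed.

HB.instance Definition _ := Choice.copy X T.
HB.instance Definition _ :=
  isOpenTopological.Build X filter_openT filter_openI filter_open_bigU.

Definition filter_topology : Topological T := Topological.class X.

Lemma opens_filter_topology W : opens filter_topology W = filter_open W.
Proof. by []. Qed.

End FilterSpace.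

(** The point [x0] turns [T] into a pointed space, the setting in which
    [compact_cover] extracts finite subcovers. *)
Lemma compact_finite_cover (T : topologicalType) (x0 : T) (A : set T)
    (I : choiceType) (D : set I) (f : I -> set T) : compact A ->
  (forall i, D i -> open (f i)) -> A `<=` \bigcup_(i in D) f i ->
  exists D' : set I,
    [/\ finite_set D', D' `<=` D & A `<=` \bigcup_(i in D') f i].
Proof.
pose T' : ptopologicalType := HB.pack T (isPointed.Build T x0).
move=> cA; have : compact (A : set T') by exact: cA.
rewrite compact_cover => cover fo Af.
have [D' D'D AD'] := cover I D f fo Af.
exists [set` D']; split=> //.
by move=> i /D'D/set_mem.
Qed.

Section Opens.
Context {G : choiceType}.
Implicit Types (s t : Topological G) (U V W : set G).

Lemma opensT t : opens t setT.
Proof. exact: (@openT (topspace t)). Qed.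

Lemma opensI t U V : opens t U -> opens t V -> opens t (U `&` V).
Proof. exact: (@openI (topspace t)). Qed.

Lemma opens_bigcup t I (D : set I) (f : I -> set G) :
  (forall i, D i -> opens t (f i)) -> opens t (\bigcup_(i in D) f i).
Proof. exact: (@bigcup_open (topspace t)). Qed.

Lemma opens_local t W :
  (forall x, W x -> exists U, [/\ opens t U, U x & U `<=` W]) -> opens t W.
Proof.
move=> Wl; suff -> : W = \bigcup_(U in [set U | opens t U /\ U `<=` W]) U.
  by apply: opens_bigcup => U [].
apply/seteqP; split=> [x /Wl[U [oU Ux UW]]|x [U [_ UW] /UW//]].
by exists U.
Qed.

Lemma hausdorffP t : hausdorff_space (topspace t) <->
  forall x y, x <> y -> exists U V,
    [/\ opens t U, opens t V, U x, V y & U `&` V = set0].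
Proof.
rewrite open_hausdorff; split=> [h x y xy|h x y /eqP xy].
  have /eqP xy' : (x : topspace t) <> y by [].
  have [[U V] /= [xU yV] [oU oV /eqP UV]] := h x y xy'.
  by exists U, V; split=> //; exact: set_mem.
have [U [V [oU oV Ux Vy UV]]] := h x y xy.
by exists (U, V) => /=; split=> //; [exact: mem_set|exact: mem_set|exact/eqP].
Qed.

Lemma coarser_hausdorff s t : coarser s t ->
  hausdorff_space (topspace s) -> hausdorff_space (topspace t).
Proof.
move=> st /hausdorffP h; apply/hausdorffP => x y /h[U [V [oU oV Ux Vy UV]]].
by exists U, V; split=> //; exact: st.
Qed.

(** The open sets of a join are described by comparing it with the topology
    that these filters define: the latter is an upper bound of [s] and [t]. *)
Definition join_nbhs s t (x : G) : set_system G :=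
  [set W | exists U V, [/\ opens s U, opens t V, U x, V x & U `&` V `<=` W]].

Lemma join_nbhs_filter s t x : Filter (join_nbhs s t x).
Proof.
split.
- by exists setT, setT; split=> //; exact: opensT.
- move=> W W' [U [V [oU oV Ux Vx UVW]]] [U' [V' [oU' oV' Ux' Vx' UVW']]].
  exists (U `&` U'), (V `&` V'); split=> //; try exact: opensI.
  by move=> y [[Uy Uy'] [Vy Vy']]; split; [exact: UVW|exact: UVW'].
- move=> W W' WW' [U [V [oU oV Ux Vx UVW]]].
  by exists U, V; split=> //; exact: subset_trans WW'.
Qed.

Lemma opens_join s t W x : opens (join_topology s t) W -> W x ->
  join_nbhs s t x W.
Proof.
pose j := filter_topology (join_nbhs_filter s t).
have jj : coarser (join_topology s t) j.
  apply: sup_topologies_least => _ [->|->] V oV;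
    rewrite opens_filter_topology => y Vy.
    by exists V, setT; split=> //; exact: opensT.
  by exists setT, V; split=> //; exact: opensT.
by move=> /jj oW Wx; exact: oW.
Qed.

Lemma coarser_joinl s t : coarser s (join_topology s t).
Proof. by apply: sup_topologies_ub; left. Qed.

Lemma coarser_joinr s t : coarser t (join_topology s t).
Proof. by apply: sup_topologies_ub; right. Qed.

(** Linearity of the family makes these neighbourhoods closed under
    intersection.  In particular, if [[set 1]] is open in the supremum of a chain
    then it is open in some member: a chain of non-discrete group topologies has
    a non-discrete supremum. *)
Definition chain_nbhs (A : set (Topological G)) (x : G) : set_system G :=
  [set W | exists t U, [/\ A t, opens t U, U x & U `<=` W]].

Lemma chain_nbhs_filter (A : set (Topological G)) x : A !=set0 ->
  (forall s t, A s -> A t -> coarser s t \/ coarser t s) ->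
  Filter (chain_nbhs A x).
Proof.
move=> [t0 At0] Ac; split.
- by exists t0, setT; split=> //; exact: opensT.
- move=> W W' [t [U [At oU Ux UW]]] [t' [U' [At' oU' Ux' UW']]].
  have [/(_ _ oU) o|/(_ _ oU') o] := Ac _ _ At At'.
    by exists t', (U `&` U'); split; [|exact: opensI| |exact: setISS].
  by exists t, (U `&` U'); split; [|exact: opensI| |exact: setISS].
- move=> W W' WW' [t [U [At oU Ux UW]]].
  by exists t, U; split=> //; exact: subset_trans WW'.
Qed.

Lemma opens_sup_chain (A : set (Topological G)) W x : A !=set0 ->
  (forall s t, A s -> A t -> coarser s t \/ coarser t s) ->
  opens (sup_topologies A) W -> W x -> chain_nbhs A x W.
Proof.
move=> A0 Ac oW Wx.
pose c := filter_topology (fun x => chain_nbhs_filter x A0 Ac).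
have sc : coarser (sup_topologies A) c.
  apply: sup_topologies_least => t At V oV; rewrite opens_filter_topology.
  by move=> y Vy; exists t, V; split.
exact: (sc _ oW).
Qed.

End Opens.

(** * Group topologies in terms of open sets *)

Section GroupTopology.
Context {G : groupType}.
Implicit Types (s t : Topological G) (U V W : set G).

Lemma group_topologyP t : group_topology t <->
  (forall W x y, opens t W -> W (x * y) -> exists U V,
     [/\ opens t U, opens t V, U x, V y
       & forall u v, U u -> V v -> W (u * v)]) /\
  (forall W, opens t W -> opens t [set x | W x^-1]).
Proof.
split=> [[ctM ctV]|[ctM ctV]]; split.
- move=> W x y oW Wxy.
  have nW : nbhs (x * y : topspace t) W.
    exact: (@open_nbhs_nbhs (topspace t)).
  have [[A B] /= [nA nB] AB] := ctM (x, y) W nW.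
  have : nbhs (y : topspace t) B by exact: nB.
  have : nbhs (x : topspace t) A by exact: nA.
  rewrite !nbhsE => -[U [oU Ux] UA] [V [oV Vy] VB].
  exists U, V; split=> // u v Uu Vv.
  by apply: (AB (u, v)); split; [exact: UA|exact: VB].
- by move=> W oW; move/continuousP: ctV => /(_ W oW).
- move=> [x y] W nW; have : nbhs (x * y : topspace t) W by exact: nW.
  rewrite nbhsE => -[W' [oW' Wxy] W'W].
  have [U [V [oU oV Ux Vy UV]]] := ctM W' x y oW' Wxy.
  exists (U, V) => /=; first by split; exact: (@open_nbhs_nbhs (topspace t)).
  by move=> [u v] [/= Uu Vv]; apply: W'W; exact: UV.
- by apply/continuousP => W; exact: ctV.
Qed.

Section Fixed.
Context {t : Topological G} (tG : group_topology t).

Lemma opens_mul W x y : opens t W -> W (x * y) -> exists U V,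
  [/\ opens t U, opens t V, U x, V y & forall u v, U u -> V v -> W (u * v)].
Proof. exact: ((group_topologyP t).1 tG).1. Qed.

Lemma opens_inv W : opens t W -> opens t [set x | W x^-1].
Proof. exact: ((group_topologyP t).1 tG).2. Qed.

Lemma opens_mull W x : opens t W -> opens t [set y | W (x * y)].
Proof.
move=> oW; apply: opens_local => y /(opens_mul oW)[U [V [oU oV Ux Vy UV]]].
by exists V; split=> // v Vv; exact: UV.
Qed.

Lemma opens_mulr W x : opens t W -> opens t [set y | W (y * x)].
Proof.
move=> oW; apply: opens_local => y /(opens_mul oW)[U [V [oU oV Uy Vx UV]]].
by exists U; split=> // u Uu; exact: UV.
Qed.

Lemma mul_continuous :
  continuous (fun p : topspace t * topspace t => (p.1 * p.2 : G) : topspace t).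
Proof. exact: tG.1. Qed.

Lemma div_nbhs W : opens t W -> W 1 -> exists U,
  [/\ opens t U, U 1, (forall u, U u -> U u^-1), U `<=` W
    & forall u v, U u -> U v -> W (u^-1 * v)].
Proof.
move=> oW W1; have W11 : W (1 * 1) by rewrite mulg1.
have [U [V [oU oV U1 V1 UV]]] := opens_mul oW W11.
pose S := U `&` V; have oS : opens t S by exact: opensI.
have S1 : S 1 by split.
exists (S `&` [set x | S x^-1]); split.
- by apply: opensI => //; exact: opens_inv.
- by split=> //=; rewrite invg1.
- by move=> u [Su Su']; split=> //=; rewrite invgK.
- by move=> u [[Uu Vu] _]; rewrite -(mulg1 u); exact: UV.
- by move=> u v [_ [Uu _]] [[_ Vv] _]; exact: UV.
Qed.

Lemma discrete1 : opens t [set 1] -> discrete t.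
Proof.
move=> o1 U; apply: opens_local => x Ux.
exists [set y | [set 1] (x^-1 * y)]; split; first exact: opens_mull.
  by rewrite /= mulVg.
by move=> y /= e; rewrite -(mulKg x^-1 y) e invgK mulg1.
Qed.

Lemma compactM (A B : set (topspace t)) : compact A -> compact B ->
  compact ([set x | exists a b, [/\ A a, B b & x = a * b]] : set (topspace t)).
Proof.
move=> cA cB.
have cf : {within A `*` B, continuous
   (fun p : topspace t * topspace t => (p.1 * p.2 : G) : topspace t)}.
  exact: continuous_subspaceT mul_continuous.
have := continuous_compact cf (compact_setX cA cB).
congr compact; apply/seteqP; split=> [_ [[a b] [/= Aa Bb] <-]|x].
  by exists a, b.
by case=> a [b [Aa Bb ->]]; exists (a, b).
Qed.

Lemma compactV (A : set (topspace t)) : compact A ->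
  compact ([set x | A x^-1] : set (topspace t)).
Proof.
have cf : {within A,
    continuous (fun x : topspace t => (x^-1 : G) : topspace t)}.
  exact: continuous_subspaceT tG.2.
move=> /(continuous_compact cf); congr compact; apply/seteqP.
split=> [_ [a Aa <-]|x Ax] /=; first by rewrite invgK.
by exists x^-1 => //; rewrite invgK.
Qed.

Lemma open_subgroup H V : is_subgroup H -> opens t V -> V 1 -> V `<=` H ->
  opens t H.
Proof.
move=> [H1 HM HV] oV V1 VH; apply: opens_local => h Hh.
exists [set y | V (h^-1 * y)]; split; first exact: opens_mull.
  by rewrite /= mulVg.
by move=> y /VH /= Hy; rewrite -(mulKg h^-1 y) invgK; exact: HM.
Qed.

Lemma open_subgroup_closed H : is_subgroup H -> opens t H ->
  closed (H : set (topspace t)).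
Proof.
move=> [H1 HM HV] oH; rewrite -[H]setCK; apply: open_closedC.
apply: (@opens_local _ t) => x nHx; exists [set y | H (x^-1 * y)]; split.
- exact: opens_mull.
- by rewrite /= mulVg.
- move=> y /= Hxy Hy; apply: nHx.
  by have := HM _ _ Hy (HV _ Hxy); rewrite invgM invgK mulVKg.
Qed.

End Fixed.

End GroupTopology.

(** * Group topologies generated by subgroups *)

(** A downward directed family of subgroups that is stable under conjugation,
    in the sense of [BJ], is a neighbourhood base of 1 for a group topology. *)
Section CosetTopology.
Context {G : groupType} (B : set (set G)).
Hypotheses (B0 : B !=set0) (Bsub : B `<=` @is_subgroup G).
Hypothesis BI : forall H K, B H -> B K -> exists2 L, B L & L `<=` H `&` K.
Hypothesis BJ : forall H x, B H -> exists2 K, B K & forall h, K h -> H (h ^ x).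

Definition coset_nbhs (x : G) : set_system G :=
  filter_from B (fun H => [set y | H (x^-1 * y)]).

Lemma coset_nbhs_filter x : Filter (coset_nbhs x).
Proof.
apply: filter_from_filter => // H K BH BK.
by have [L BL LHK] := BI BH BK; exists L => // y /LHK.
Qed.

Definition coset_topology : Topological G := filter_topology coset_nbhs_filter.

Lemma opens_coset H x : B H -> opens coset_topology [set y | H (x^-1 * y)].
Proof.
move=> BH; rewrite opens_filter_topology => y /= Hxy; exists H => // z /= Hyz.
have [_ HM _] := Bsub BH.
by rewrite -(mulVKg y z) mulgA; exact: HM.
Qed.

Lemma opens_coset1 H : B H -> opens coset_topology H.
Proof.
move=> BH; rewrite (_ : H = [set y | H (1^-1 * y)]); first exact: opens_coset.
by apply/seteqP; split=> x /=; rewrite invg1 mul1g.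
Qed.

Lemma coset_topology_group : group_topology coset_topology.
Proof.
apply/group_topologyP; split=> [W x y|W]; rewrite !opens_filter_topology => oW.
  move=> Wxy; have [H BH HW] := oW _ Wxy; have [K BK KH] := BJ y BH.
  have [[H1 HM _] [K1 _ _]] := (Bsub BH, Bsub BK).
  exists [set u | K (x^-1 * u)], [set v | H (y^-1 * v)].
  split; [exact: opens_coset|exact: opens_coset| | |] => /=; rewrite ?mulVg //.
  move=> u v /KH Hu Hv; apply: HW => /=.
  have := HM _ _ Hu Hv; congr H.
  by rewrite conjgE invgM !mulgA mulgK.
move=> x /= Wx; have [H BH HW] := oW _ Wx; have [K BK KH] := BJ x^-1 BH.
have [[_ _ HV] [_ _ KV]] := (Bsub BH, Bsub BK).
exists K => // y /= /KV/KH; rewrite conjgE invgM !invgK => Hxy.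
by apply: HW; rewrite /= invgK; move: Hxy; rewrite -!mulgA mulgV mulg1.
Qed.

Lemma coset_topology_hausdorff :
  (forall x, x <> 1 -> exists2 H, B H & ~ H x) ->
  hausdorff_space (topspace coset_topology).
Proof.
move=> Bsep; apply/hausdorffP => x y xy.
have [H BH nH] : exists2 H, B H & ~ H (x^-1 * y).
  by apply: Bsep => e; apply: xy; rewrite -[y](mulVKg x) e mulg1.
have [H1 HM HV] := Bsub BH.
exists [set z | H (x^-1 * z)], [set z | H (y^-1 * z)].
split; [exact: opens_coset|exact: opens_coset| | |]; rewrite /= ?mulVg //.
apply/seteqP; split=> // z [/= Hx Hy]; apply: nH.
by have := HM _ _ Hx (HV _ Hy); rewrite invgM invgK -mulgA mulVKg.
Qed.

Lemma coset_topology_coarser (t : Topological G) : group_topology t ->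
  (forall H, B H -> opens t H) -> coarser coset_topology t.
Proof.
move=> tG oB W; rewrite opens_filter_topology => oW.
apply: opens_local => x Wx; have [H BH HW] := oW _ Wx.
exists [set y | H (x^-1 * y)]; split=> //.
  by apply: opens_mull => //; exact: oB.
by rewrite /= mulVg; case: (Bsub BH).
Qed.

End CosetTopology.

(** * Maximal topologies and transversality *)

Section Transversal.
Context {G : groupType}.
Implicit Types (s t : Topological G) (U V W : set G).

(** Zorn's lemma: by [opens_sup_chain] the supremum of a chain of non-discrete
    group topologies is not discrete, and it inherits the Hausdorff property
    from any member. *)
Lemma maximal_above t : nondiscrete_group_topology t ->
  exists2 m, maximal_group_topology m & coarser t m.
Proof.
move=> tN; pose T := {s | nondiscrete_group_topology s /\ coarser t s}.
have tT : nondiscrete_group_topology t /\ coarser t t by split.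
pose R (a b : T) := `[< coarser (sval a) (sval b) >].
have [[m [mN tm]] mR] : exists m, premaximal R m.
  apply: (ZL_preorder (exist _ t tT : T)) => [a|b a c|A Atot].
  - by apply/asboolP.
  - by move=> /asboolP ab /asboolP bc; apply/asboolP; exact: subset_trans bc.
  (* the empty chain is bounded by [t] itself *)
  have [[a0 Aa0]|A0] := pselect (A !=set0); last first.
    by exists (exist _ t tT) => a Aa; case: A0; exists a.
  pose P := [set sval a | a in A].
  have P0 : P !=set0 by exists (sval a0); exists a0.
  have Pc : forall r s, P r -> P s -> coarser r s \/ coarser s r.
    move=> _ _ [a Aa <-] [b Ab <-].
    by have [/asboolP|/asboolP] := Atot a b Aa Ab; [left|right].
  have PN s : P s -> nondiscrete_group_topology s by case=> -[r []] ? ? _ <-.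
  have Pu s : P s -> coarser s (sup_topologies P).
    exact: sup_topologies_ub.
  have Pa0 : P (sval a0) by exists a0.
  have uT : nondiscrete_group_topology (sup_topologies P) /\
            coarser t (sup_topologies P).
    split; last by apply: subset_trans (Pu _ Pa0); case: (svalP a0).
    have [[_ h0] _] := PN _ Pa0; split; first split.
    - by apply: group_topology_sup => s /PN[[]].
    - exact: coarser_hausdorff (Pu _ Pa0) h0.
    - move=> /(_ [set 1]) o1.
      have [//|s [U [Ps oU U1 U11]]] := opens_sup_chain P0 Pc o1 (x := 1) _.
      have [[sG _]] := PN _ Ps; apply; apply: discrete1 => //.
      suff <- : U = [set 1] by [].
      by apply/seteqP; split=> // _ ->.
  exists (exist _ (sup_topologies P) uT : T) => a Aa.
  by apply/asboolP; apply: Pu; exists a.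
exists m => //; split=> // s sN ms.
have sT : nondiscrete_group_topology s /\ coarser t s.
  by split=> //; exact: subset_trans ms.
by have /asboolP := mR (exist _ s sT : T) (asboolT ms).
Qed.

(** The infimum of the maximal topologies is taken among group topologies, so
    it suffices to exhibit one group topology below all of them in which [H] is
    open: the one generated by all the subgroups that are open in every maximal
    topology. *)
Lemma opens_submaximal H : is_subgroup H ->
  (forall m, maximal_group_topology m -> opens m H) ->
  opens (submaximal_topology G) H.
Proof.
move=> sH oH.
pose B := [set K : set G | is_subgroup K /\
  forall m, maximal_group_topology m -> opens m K].
have B0 : B !=set0 by exists H.
have Bsub : B `<=` @is_subgroup G by move=> K [].
have BI K L : B K -> B L -> exists2 M, B M & M `<=` K `&` L.
  move=> [[K1 KM KV] oK] [[L1 LM LV] oL]; exists (K `&` L) => //; split.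
    split=> [//|x y [? ?] [? ?]|x [? ?]].
      by split; [exact: KM|exact: LM].
    by split; [exact: KV|exact: LV].
  by move=> m mM; apply: opensI; [exact: oK|exact: oL].
have BJ K x : B K -> exists2 L, B L & forall h, L h -> K (h ^ x).
  move=> [[K1 KM KV] oK]; exists [set h | K (h ^ x)] => //; split.
    split=> [|y z Ky Kz|y Ky] /=; first by rewrite conj1g.
      by rewrite conjMg; exact: KM.
    by rewrite conjVg; exact: KV.
  move=> m mM; have [[[mG _] _] _] := mM.
  exact: (opens_mulr mG x (opens_mull mG x^-1 (oK m mM))).
have := coset_topology_group B0 Bsub BI BJ.
move=> /inf_group_topology_greatest/(_ _).
move=> /(_ (@maximal_group_topology G)) c; apply: c.
  move=> m mM; have [[[mG _] _] _] := mM.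
  by apply: coset_topology_coarser => // K [_]; exact.
exact: opens_coset1.
Qed.

(** If the join of [t] with a maximal topology [m] were not discrete, then by
    maximality it would be [m], and [F] would be open in [m]. *)
Lemma nonopen_transversal t F : nondiscrete_group_topology t ->
  is_subgroup F -> opens t F -> ~ opens (submaximal_topology G) F ->
  admits_transversal t.
Proof.
move=> tN sF oF noF.
have [m mM nomF] : exists2 m, maximal_group_topology m & ~ opens m F.
  apply: contrapT => nm; apply: noF; apply: opens_submaximal => // m mM.
  by apply: contrapT => nomF; apply: nm; exists m.
have [mN mmax] := mM; have [[mG mH] _] := mN; have [[tG _] _] := tN.
exists m; split=> //; apply: contrapT => nd.
have jN : nondiscrete_group_topology (join_topology t m).
  split=> //; split; first by apply: group_topology_sup => s [->|->].
  exact: coarser_hausdorff (@coarser_joinr _ t m) mH.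
apply: nomF; apply: mmax jN (@coarser_joinr _ _ _) _ _.
exact: coarser_joinl.
Qed.

Lemma compact_finite_cosets t (tG : group_topology t) F U :
  compact (F : set (topspace t)) -> opens t U -> U 1 ->
  exists2 D : set G, finite_set D &
    F `<=` \bigcup_(g in D) [set x | U (g^-1 * x)].
Proof.
move=> cF oU U1.
have [||D [fD _ DF]] := @compact_finite_cover (topspace t) 1 F G setT
  (fun g => [set x | U (g^-1 * x)]) cF.
- by move=> g _; exact: (opens_mull tG).
- by move=> x _; exists x => //=; rewrite mulVg.
- by exists D.
Qed.

Lemma finite_nbhs_discrete t U : hausdorff_group_topology t ->
  opens t U -> U 1 -> finite_set U -> discrete t.
Proof.
move=> [tG tH] oU U1 fU; apply: discrete1 => //.
have cU : closed (U `\ 1 : set (topspace t)).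
  apply: accessible_finite_set_closed.1; first exact: hausdorff_accessible.
  exact: finite_setD.
have := opensI oU (@closed_openC _ _ cU : opens t (~` (U `\ 1))).
congr opens; apply/seteqP; split=> [x [Ux nUx]|_ ->] /=.
  by apply: contrapT => x1; apply: nUx.
by split=> // -[].
Qed.

Lemma transversal_separated s t : Defs.transversal s t ->
  exists U V, [/\ opens s U, opens t V, U 1, V 1 & U `&` V `<=` [set 1]].
Proof. by move=> [_ _ d]; exact: (opens_join (d [set 1])). Qed.

(** Write [U] and [V] for neighbourhoods of 1, for [s] and [t] respectively,
    that meet only in 1.  If the quotients of elements of [U'] are in [U] and
    those of elements of [V'] are in [V], then a coset of [U'] contains at most
    one element of [V'].  Finitely many such cosets cover [F], so the
    [t]-neighbourhood [V' `&` F] of 1 is finite. *)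
Lemma compact_transversal_not_open s t F : Defs.transversal s t ->
  F 1 -> compact (F : set (topspace s)) -> ~ opens t F.
Proof.
move=> st F1 cF oF; have [U [V [oU oV U1 V1 UV]]] := transversal_separated st.
have [[[sG _] _] [tHG tN] _] := st; have [tG _] := tHG.
have [U' [oU' U'1 U'V _ U'U]] := div_nbhs sG oU U1.
have [V' [oV' V'1 V'V _ V'V2]] := div_nbhs tG oV V1.
have [D fD DF] := compact_finite_cosets sG cF oU' U'1.
apply: tN; apply: (finite_nbhs_discrete tHG (opensI oV' oF)) => //.
apply: (@sub_finite_set _ _
  (\bigcup_(g in D) [set x | V' x /\ U' (g^-1 * x)])).
  by move=> x [V'x /DF[g Dg U'gx]]; exists g.
apply: bigcup_finite => // g _.
have [[x0 [V'x0 U'x0]]|no] := pselect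
  (exists x, V' x /\ U' (g^-1 * x)); last first.
  suff -> : [set x | V' x /\ U' (g^-1 * x)] = set0 by exact: finite_set0.
  by apply/seteqP; split=> x // Px; case: no; exists x.
apply: (@sub_finite_set _ _ [set x0]) => // x [V'x U'x] /=.
have e : x0^-1 * x = 1.
  apply: UV; split; last exact: V'V2.
  by have := U'U _ _ U'x0 U'x; rewrite invgM invgK -mulgA mulVKg.
by rewrite -(mulVKg x0 x) e mulg1.
Qed.

Lemma compact_transversal_not_open_submaximal t F : admits_transversal t ->
  F 1 -> compact (F : set (topspace t)) -> ~ opens (submaximal_topology G) F.
Proof.
move=> [d [tN dN dj]] F1 cF oF.
have [m mM dm] := maximal_above dN.
have tm : Defs.transversal t m.
  split=> //; first by case: mM.
  suff : coarser (join_topology t d) (join_topology t m).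
    by move=> c U; apply: c; exact: dj.
  apply: sup_topologies_least => _ [->|->]; first exact: coarser_joinl.
  exact: subset_trans (@coarser_joinr _ _ _).
apply: (compact_transversal_not_open tm F1 cF).
exact: (inf_group_topology_lb mM).
Qed.

End Transversal.

(** * Central discrete copies of the integers *)

Section IntegerPowers.
Context {G : groupType}.
Implicit Types (x y : G) (m n : int).

Definition zpow x m : G :=
  match m with Posz n => x ^+ n | Negz n => x ^- n.+1 end.

Lemma zpowS x m : zpow x (m + 1)%R = zpow x m * x.
Proof.
case: m => [n|[|n]].
- by rewrite (_ : (n%:Z + 1)%R = n.+1) ?[LHS]expgSr //; lia.
- by rewrite (_ : (Negz 0 + 1)%R = 0%N) //= expg1 mulVg.
- rewrite (_ : (Negz n.+1 + 1)%R = Negz n) /=; last by lia.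
  by rewrite (expgS x n.+1) invgM mulgVK.
Qed.

Lemma zpowD x m n : zpow x (m + n)%R = zpow x m * zpow x n.
Proof.
elim/int_rect: n => [|n IHn|n IHn]; first by rewrite GRing.addr0 mulg1.
  rewrite (_ : (m + n.+1%:Z)%R = (m + n + 1)%R); last by lia.
  by rewrite zpowS IHn -mulgA -zpowS; congr (_ * zpow _ _); lia.
apply: (@mulIg _ x); rewrite -mulgA -!zpowS.
rewrite (_ : (m - n.+1%:Z + 1)%R = (m - n%:Z)%R); last by lia.
by rewrite IHn; congr (_ * zpow _ _); lia.
Qed.

Lemma zpowN x m : zpow x (- m)%R = (zpow x m)^-1.
Proof. by apply/esym/mulg1_eq; rewrite -zpowD GRing.subrr. Qed.

Lemma zpow_subgroup x : is_subgroup (range (zpow x)).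
Proof.
split=> [|_ _ [m _ <-] [n _ <-]|_ [m _ <-]]; first by exists 0%R.
  by exists (m + n)%R; rewrite ?zpowD.
by exists (- m)%R; rewrite ?zpowN.
Qed.

Lemma zpow_central x m : center G x -> center G (zpow x m).
Proof.
move=> Zx y; apply/commute_sym; have /commute_sym Zxy := Zx y.
by case: m => n /=; [exact: commuteX|apply/commuteV/commuteX].
Qed.

End IntegerPowers.

Section DiscreteZ.
Context {G : groupType}.
Implicit Types (t : Topological G).

Lemma isomorphic_to_discrete_ZP t (C : set G) : isomorphic_to_discrete_Z t C ->
  exists phi : int -> G, [/\ {morph phi : m n / (m + n)%R >-> m * n},
    injective phi, range phi `<=` C
    & exists U, [/\ opens t U, U 1 & forall m, U (phi m) -> m = 0%R]].
Proof.
move=> [f [g [fK gK _ cg fD]]].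
pose phi m : G := set_val (f m).
have phiD : {morph phi : m n / (m + n)%R >-> m * n} by exact: fD.
have phi0 : phi 0%R = 1.
  by apply: (@mulgI _ (phi 0%R)); rewrite -phiD GRing.addr0 mulg1.
exists phi; split=> //.
- move=> m n mn; rewrite -(fK m) -(fK n); congr g; exact: val_inj.
- by move=> _ [m _ <-]; exact: set_mem (valP (f m)).
have := (continuousP _).1 cg [set 0%R] (discrete_open _).
move=> [U oU Ug]; exists U; split=> //.
  have : (set_val @^-1` U) (f 0%R) by rewrite Ug /= fK.
  by rewrite /= -phi0.
move=> m Um; have : (g @^-1` [set 0%R]) (f m) by rewrite -Ug.
by rewrite /= fK.
Qed.

(** The transversal topology has the subgroups [phi (n Z)] with [n > 0] as
    neighbourhoods of 1; they are normal because they are central.  The subgroup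
    [phi Z] is open in it and discrete for [t], so its join with [t] is
    discrete. *)
Lemma central_discrete_Z_transversal t (phi : int -> G) U :
  nondiscrete_group_topology t ->
  {morph phi : m n / (m + n)%R >-> m * n} -> injective phi ->
  range phi `<=` center G -> opens t U -> U 1 ->
  (forall m, U (phi m) -> m = 0%R) -> admits_transversal t.
Proof.
move=> tN phiD phiI phiZ oU U1 U0; have [[tG tH] _] := tN.
have phi0 : phi 0%R = 1.
  by apply: (@mulgI _ (phi 0%R)); rewrite -phiD GRing.addr0 mulg1.
have phiN m : phi (- m)%R = (phi m)^-1.
  by apply/esym/mulg1_eq; rewrite -phiD GRing.subrr.
pose H (n : nat) : set G := [set phi (n%:Z * k)%R | k in setT].
pose B := [set H n | n in [set n : nat | (0 < n)%N]].
have B0 : B !=set0 by exists (H 1%N), 1%N.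
have Bsub : B `<=` @is_subgroup G.
  move=> _ [n _ <-]; split=> [|_ _ [k _ <-] [l _ <-]|_ [k _ <-]].
  - by exists 0%R => //; rewrite GRing.mulr0.
  - by exists (k + l)%R; rewrite // -phiD GRing.mulrDr.
  - by exists (- k)%R; rewrite // -phiN GRing.mulrN.
have BI K L : B K -> B L -> exists2 M, B M & M `<=` K `&` L.
  move=> [m m0 <-] [n n0 <-]; exists (H (m * n)%N).
    by exists (m * n)%N => //=; rewrite muln_gt0; apply/andP.
  move=> _ [k _ <-]; split.
    by exists (n%:Z * k)%R => //; congr phi; lia.
  by exists (m%:Z * k)%R => //; congr phi; lia.
have BJ K x : B K -> exists2 L, B L & forall h, L h -> K (h ^ x).
  move=> BK; exists K => // h Kh; have [n _ eK] := BK.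
  move: Kh; rewrite -eK => -[k _ <-].
  have Zk : center G (phi (n%:Z * k)%R) by apply: phiZ; exists (n%:Z * k)%R.
  by exists k => //; rewrite conjgE Zk mulKg.
pose d := coset_topology B0 BI.
have dG : group_topology d by exact: coset_topology_group.
have oB K : B K -> opens d K by exact: opens_coset1.
exists d; split=> //.
  split; first split=> //.
    apply: coset_topology_hausdorff => // x x1.
    have [[k _ ek]|nphi] := pselect (range phi x); last first.
      exists (H 1%N); first by exists 1%N.
      by move=> [k _ ek]; apply: nphi; exists (1 * k)%R.
    (* a nonzero [k] is not a multiple of [`|k| + 1] *)
    exists (H `|k|.+1); first by exists `|k|.+1.
    rewrite -ek => -[l _ /phiI kl].
    have k0 : k = 0%R by have [l0|l0] := eqVneq l 0%R; nia.
    by apply: x1; rewrite -ek k0.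
  move=> /(_ [set 1]); rewrite opens_filter_topology => /(_ 1 erefl).
  move=> [_ [n /= n0 <-] Hn].
  have : phi n = 1.
    by apply: Hn; exists 1%R; rewrite //= invg1 mul1g; congr phi; lia.
  by rewrite -phi0 => /phiI; lia.
have jG : group_topology (join_topology t d).
  by apply: group_topology_sup => s [->|->].
apply: discrete1 => //.
have oUH : opens (join_topology t d) (U `&` H 1%N).
  apply: opensI; first exact: coarser_joinl.
  by apply: coarser_joinr; apply: oB; exists 1%N.
suff <- : U `&` H 1%N = [set 1] by [].
apply/seteqP; split=> [_ [/[swap] [[k _ <-]] /U0 -> //]|_ ->].
by split=> //; exists 0%R => //; rewrite GRing.mulr0.
Qed.

End DiscreteZ.

(** * Recurrent elements *)

Section Recurrence.
Context {G : groupType} {t : Topological G} (tG : group_topology t).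
Implicit Types (z : G) (U V : set G).

Definition recurrent z : Prop :=
  forall U, opens t U -> U 1 -> exists2 n, (0 < n)%N & U (z ^+ n).

(** Products of returns to small neighbourhoods give arbitrarily late returns,
    whether the order of [z] is finite or not. *)
Lemma recurrent_large z U N : recurrent z -> opens t U -> U 1 ->
  exists2 n, (N < n)%N & U (z ^+ n).
Proof.
move=> rz; elim: N U => [|N IHN] U oU U1; first exact: rz.
have U11 : U (1 * 1) by rewrite mulg1.
have [V [W [oV oW V1 W1 VW]]] := opens_mul tG oU U11.
have [m Nm Vm] := IHN V oV V1; have [n n0 Wn] := rz W oW W1.
by exists (m + n)%N; [lia|rewrite expgnDr; exact: VW].
Qed.

(** A neighbourhood of 1 that contains no positive power of [z] shows at once
    that [z] has infinite order and that its powers form a discrete subset. *)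
Lemma not_recurrent_discrete_Z z : center G z -> ~ recurrent z ->
  exists C : set G, [/\ is_subgroup C, C `<=` center G
    & isomorphic_to_discrete_Z t C].
Proof.
move=> Zz nr.
have [U [oU U1 Un]] : exists U,
    [/\ opens t U, U 1 & forall n, (0 < n)%N -> ~ U (z ^+ n)].
  apply: contrapT => nU; apply: nr => U oU U1; apply: contrapT => nn.
  by apply: nU; exists U; split=> // n n0 Un; apply: nn; exists n.
have [S [oS S1 SV SU _]] := div_nbhs tG oU U1.
have S0 m : S (zpow z m) -> m = 0%R.
  case: m => [[//|n]|n] /= Sm; first by case: (Un n.+1 isT); exact: SU.
  by case: (Un n.+1 isT); apply: SU; rewrite -[z ^+ _]invgK; exact: SV.
have zI : injective (zpow z).
  move=> m n mn; suff : (m - n)%R = 0%R by lia.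
  by apply: S0; rewrite zpowD zpowN mn mulgV.
pose C : set (topspace t) := range (zpow z).
have fC m : zpow z m \in C by apply: mem_set; exists m.
have gC (c : set_type C) : exists m, zpow z m = set_val c.
  by have [m _ e] := set_mem (valP c); exists m; exact: e.
pose f (m : discrete_topology int) : set_type C := exist _ (zpow z m) (fC m).
pose g (c : set_type C) : discrete_topology int := projT1 (cid (gC c)).
have gP c : zpow z (g c) = set_val c by rewrite /g; case: cid.
exists C; split; first exact: zpow_subgroup.
  by move=> _ [m _ <-]; exact: zpow_central.
exists f, g; split.
- by move=> m; apply: zI; rewrite gP.
- by move=> c; apply: val_inj; rewrite /= gP.
- by apply/continuousP => W _; exact: discrete_open.
- apply/continuousP => W _.
  exists (\bigcup_(m in W) [set x | S (zpow z (- m)%R * x)]).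
    by apply: (@opens_bigcup _ t) => m _; exact: (opens_mull tG).
  apply/seteqP; split=> [c [m Wm]|c Wc] /=.
    rewrite -gP -zpowD => /S0 e.
    by suff -> : g c = m by []; apply/esym/eqP; rewrite -GRing.subr_eq0; lia.
  by exists (g c) => //=; rewrite -gP -zpowD GRing.addNr.
- by move=> m n; exact: (zpowD z m n).
Qed.

(** Let [V] be a neighbourhood of 1 inside [K].  Recurrence brings every point
    of the closure of the powers of [z] into [V] by a positive power of [z]; by
    compactness of [K], finitely many exponents [1 .. N] suffice for the points
    that lie in [K].  Given a power [zpow z m], let [n] be least with
    [zpow z (m - n)] in [V]: some [i] between 1 and [N] gives
    [zpow z (m - n + i)] in [V], so [n < i] by minimality.  Hence all the powers
    lie in the union of the [z ^+ n * K] with [n < N]. *)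
Lemma recurrent_powers_compact z (K : set (topspace t)) V :
  recurrent z -> compact K -> opens t V -> V 1 -> V `<=` K ->
  exists2 L : set (topspace t), compact L & range (zpow z) `<=` L.
Proof.
move=> rz cK oV V1 VK; have [S [oS S1 SV SsubV SSV]] := div_nbhs tG oV V1.
pose cl := closure (range (zpow z) : set (topspace t)).
have cKcl : compact (K `&` cl).
  by apply: compact_closedI => //; exact: closed_closure.
have [||D [fD D0 KD]] := @compact_finite_cover (topspace t) 1 (K `&` cl)
  nat [set i | (0 < i)%N] (fun i => [set x | V (z ^+ i * x)]) cKcl.
- by move=> i _; exact: (opens_mull tG).
- move=> x [_ clx].
  have nx : nbhs (x : topspace t) [set y | S (x^-1 * y)].
    apply: (@open_nbhs_nbhs (topspace t)); split; last by rewrite /= mulVg.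
    exact: (opens_mull tG).
  have [_ [[m _ <-] /= /SV Sm]] := clx _ nx.
  have [n mn Sn] := recurrent_large `|m| rz oS S1.
  exists (absz (n%:Z - m)%R); first by rewrite /=; lia.
  (* [z ^+ n] and [(zpow z m)^-1 * x] are both small, hence so is their
     product *)
  have := SSV _ _ (SV _ Sn) Sm; rewrite /= invgK invgM invgK mulgA.
  by rewrite -[z ^+ n]/(zpow z n) -zpowN -zpowD
     (_ : (n%:Z - m)%R = absz (n%:Z - m)%R) //; lia.
have [s Ds] := (finite_seqP D).1 fD.
pose N := \max_(i <- s) i.
have DN i : D i -> (i <= N)%N.
  by rewrite Ds => /= si; exact: (@leq_bigmax_seq _ s xpredT id i).
exists [set x | exists a b,
  [/\ ((fun n => z ^+ n) @` `I_N) a, K b & x = a * b]].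
  apply: compactM => //; apply: finite_compact; exact: finite_image.
move=> _ [m _ <-].
have exn : exists n : nat, `[< V (zpow z (m - n%:Z)%R) >].
  have [n mn Sn] := recurrent_large `|m| rz oS S1.
  exists (absz (m + n%:Z)%R); apply/asboolP/SsubV.
  rewrite (_ : (m - _)%R = (- n%:Z)%R); last by lia.
  by rewrite zpowN; exact: SV.
case: (ex_minnP exn) => n /asboolP Vn nmin.
have [|i Di Vi] := KD (zpow z (m - n%:Z)%R).
  by split; [exact: VK|apply: subset_closure; exists (m - n%:Z)%R].
have i0 := D0 _ Di; have iN := DN _ Di; rewrite /= in i0.
have ni : (n < i)%N.
  rewrite ltnNge; apply/negP => le_in.
  suff /nmin : `[< V (zpow z (m - (n - i)%N%:Z)%R) >] by lia.
  apply/asboolP; move: Vi; rewrite /= -[z ^+ i]/(zpow z i) -zpowD.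
  by congr (V (zpow _ _)); lia.
exists (z ^+ n), (zpow z (m - n%:Z)%R); split; last 1 first.
- by rewrite -[z ^+ n]/(zpow z n) -zpowD; congr zpow; lia.
- by exists n => //=; lia.
- exact: VK.
Qed.

(** By induction on the size of [D], [A] is a product of cyclic subgroups; it is a
    subgroup since these are central, and lies in a product of compact sets. *)
Lemma finite_central_compact (D : set G) : finite_set D -> D `<=` center G ->
  (forall z, D z ->
    exists2 L : set (topspace t), compact L & range (zpow z) `<=` L) ->
  exists (A : set G) (L : set (topspace t)),
    [/\ is_subgroup A, A `<=` center G, D `<=` A, compact L & A `<=` L].
Proof.
move=> /finite_seqP[s ->]; elim: s => [|z s IHs] sZ sL.
  exists [set 1], [set 1]; split=> //; last exact: compact_set1.
    by split=> [|_ _ -> ->|_ ->]; rewrite ?mulg1 ?invg1.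
  by move=> _ ->; case: (center_subgroup G).
have [||A [L [[A1 AM AV] AZ sA cL AL]]] := IHs.
- by move=> y sy; apply: sZ; rewrite /= inE; apply/orP; right.
- by move=> y sy; apply: sL; rewrite /= inE; apply/orP; right.
have zs : [set` z :: s] z by rewrite /= inE eqxx.
have [Lz cLz zLz] := sL _ zs.
have Zz m : center G (zpow z m) by apply: zpow_central; exact: sZ.
have [_ ZM ZV] := center_subgroup G.
exists [set x | exists a m, A a /\ x = a * zpow z m].
exists [set x | exists a b, [/\ L a, Lz b & x = a * b]]; split.
- split=> [|_ _ [a [m [Aa ->]]] [b [n [Ab ->]]]|_ [a [m [Aa ->]]]].
  + by exists 1, 0%R; split=> //; rewrite mulg1.
  + exists (a * b), (m + n)%R; split; first exact: AM.
    by rewrite zpowD -!mulgA; congr (_ * _); rewrite !mulgA Zz.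
  + exists a^-1, (- m)%R; split; first exact: AV.
    by rewrite invgM -zpowN Zz.
- by move=> _ [a [m [/AZ Za ->]]]; exact: ZM.
- move=> y; rewrite /= inE => /orP[/eqP ->|/sA Ay].
    by exists 1, 1%R; split=> //; rewrite mul1g.
  by exists y, 0%R; split=> //; rewrite mulg1.
- exact: compactM.
- move=> _ [a [m [Aa ->]]]; exists a, (zpow z m).
  by split=> //; [exact: AL|apply: zLz; exists m].
Qed.

End Recurrence.

(** * Compact open subgroups of central groups *)

Section CentralGroups.
Context {G : groupType} {t : Topological G}.
Hypothesis tC : central_topological_group t.

Let tG : group_topology t. Proof. by case: tC => -[]. Qed.

(** The projection onto [G / Z(G)] is open, so finitely many translates of a
    compact neighbourhood of 1 have interiors that project onto the quotient;
    adding the inverses makes their union symmetric. *)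
Lemma compact_nbhs_mod_center : exists (K : set (topspace t)) (V : set G),
  [/\ compact K, opens t V, V 1, V `<=` K & forall x, K x -> K x^-1] /\
  (forall g, exists v z, [/\ V v, center G z & g = v * z]).
Proof.
have [_ lct cQ] := tC.
have [K0 nK0 [cK0 _]] := lct 1 I.
have : nbhs (1 : topspace t) K0.
  move: nK0; rewrite /globally /within /= => nK0.
  have F1 := nbhs_filter (1 : topspace t).
  by apply: (@filterS _ _ F1 _ _ _ nK0) => x; exact.
rewrite nbhsE => -[U [oU U1] UK0].
pose Q := @quotient_topology (topspace t) (center_quotient G).
pose p (x : G) : Q := \pi_(center_quotient G)%qT x.
have pE x y : p x = p y <-> center G (x^-1 * y).
  have e := @eqmodP G (center_equiv G) x y.
  by split=> [/e/asboolP//|Zxy]; apply/e/asboolP.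
have [_ ZM ZV] := center_subgroup G.
have [||D [fD _ DQ]] := @compact_finite_cover Q (p 1) setT G setT
  (fun x => [set q | exists2 u, U (x^-1 * u) & q = p u]) cQ.
- move=> x _; apply: (@opens_local _ t) => y /= [u Uu /pE Zyu].
  exists [set w | U (x^-1 * (w * (y^-1 * u)))]; split.
  + exact: (opens_mulr tG (y^-1 * u) (opens_mull tG x^-1 oU)).
  + by rewrite /= mulVKg.
  + move=> w Uw; exists (w * (y^-1 * u)) => //; apply/pE.
    by rewrite mulKg.
- move=> q _; exists (repr q) => //; exists (repr q); rewrite ?mulVg //.
  by rewrite /p reprK.
(* the translate by 1 ensures that [V] is a neighbourhood of 1 *)
pose D1 := D `|` [set 1].
pose K1 : set (topspace t) := [set x | exists a b, [/\ D1 a, K0 b & x = a * b]].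
pose V := \bigcup_(d in D1) [set x | U (d^-1 * x)].
have cK1 : compact K1.
  apply: compactM => //; apply: finite_compact.
  by rewrite /D1 finite_setU; split.
exists (K1 `|` [set x | K1 x^-1]), V; split; first split.
- by apply: compactU => //; exact: compactV.
- by apply: opens_bigcup => d _; exact: opens_mull.
- by exists 1; [right|rewrite /= mulVg].
- move=> x [d Dd /UK0 Kdx]; left; exists d, (d^-1 * x).
  by rewrite mulVKg.
- by move=> x [Kx|Kx]; [right; rewrite /= invgK|left].
move=> g; have [d Dd [u Uu /pE Zgu]] := DQ (p g) I.
exists u, (u^-1 * g); split; [by exists d => //; left| |by rewrite mulVKg].
by have := ZV _ Zgu; rewrite invgM invgK.
Qed.

(** With [K] as in the previous lemma, [K * K] is contained in [K * D] for a
    finite set [D] of central elements.  If [A] is a central subgroup that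
    contains [D], then [F = K * A] satisfies [F * F = K * K * A = K * A].  It is
    open, hence closed, and lies in [K * L] when [A] lies in [L], so it is
    compact for compact [L]. *)
Lemma compact_open_subgroup : (forall z, center G z -> recurrent (t := t) z) ->
  exists F : set G,
    [/\ is_subgroup F, opens t F & compact (F : set (topspace t))].
Proof.
move=> Zr.
have [K [V [[cK oV V1 VK KV] VZ]]] := compact_nbhs_mod_center.
have [_ ZM ZV] := center_subgroup G.
have [||D [fD DZ KD]] := @compact_finite_cover (topspace t) 1
  [set x | exists a b, [/\ K a, K b & x = a * b]] G (center G)
  (fun z => [set x | V (x * z^-1)]) (compactM tG cK cK).
- by move=> z _; exact: (opens_mulr tG).
- move=> x _; have [v [z [Vv Zz ->]]] := VZ x.
  by exists z => //=; rewrite mulgK.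
have [|A [L [[A1 AM AV] AZ DA cL AL]]] := finite_central_compact tG fD DZ.
  move=> z /DZ/Zr rz; exact: (recurrent_powers_compact tG rz cK oV V1 VK).
pose F := [set x | exists k a, [/\ K k, A a & x = k * a]].
have sF : is_subgroup F.
  split=> [|_ _ [k [a [Kk Aa ->]]] [l [b [Kl Ab ->]]]|_ [k [a [Kk Aa ->]]]].
  - by exists 1, 1; split=> //; [exact: VK|rewrite mulg1].
  - have [|z Dz Vz] := KD (k * l); first by exists k, l.
    exists (k * l * z^-1), (z * (a * b)); split; first exact: VK.
      by exact: (AM _ _ (DA _ Dz) (AM _ _ Aa Ab)).
    by rewrite !mulgA mulgVK -(mulgA k l a) -(AZ a Aa l) !mulgA.
  - exists k^-1, a^-1; split; [exact: KV|exact: AV|].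
    by rewrite invgM (ZV _ (AZ _ Aa)).
have oF : opens t F.
  apply: (open_subgroup tG sF oV V1) => v Vv; exists v, 1.
  by split=> //; [exact: VK|rewrite mulg1].
exists F; split=> //.
apply: (@subclosed_compact (topspace t) _
  [set x | exists a b, [/\ K a, L b & x = a * b]]).
- exact: open_subgroup_closed.
- exact: compactM.
- by move=> _ [k [a [Kk /AL La ->]]]; exists k, a.
Qed.

End CentralGroups.

(** * The characterization *)

Theorem theorem5p1 (G : groupType) (tau : Topological G)
    (Gcentral : central_topological_group tau)
    (Gnondiscrete : ~ discrete tau) :
  admits_transversal tau <->
  (exists C : set G,
     [/\ is_subgroup C, C `<=` center G
       & isomorphic_to_discrete_Z tau C])
  \/
  (exists F : set G,
     [/\ is_subgroup F, opens tau F, compact (F : set (topspace tau))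
       & ~ opens (submaximal_topology G) F]).
Proof.
have [tH _ _] := Gcentral; have [tG _] := tH.
split=> [aT|[[C [_ CZ]]|[F [sF oF _ noF]]]].
- have [Zr|] := pselect (forall z, center G z -> recurrent (t := tau) z).
    have [F [sF oF cF]] := compact_open_subgroup Gcentral Zr.
    right; exists F; split=> //.
    have [F1 _ _] := sF.
    exact: compact_transversal_not_open_submaximal aT F1 cF.
  move=> /existsNP[z /not_implyP[Zz nrz]]; left.
  exact: not_recurrent_discrete_Z nrz.
- move=> /isomorphic_to_discrete_ZP[phi [phiD phiI phiC [U [oU U1 U0]]]].
  apply: (central_discrete_Z_transversal (U := U) _ phiD phiI) => //.
  exact: subset_trans CZ.
- exact: (nonopen_transversal _ sF oF noF).
Qed.
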